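(* Let $\mathcal M=(\mathcal S,\mathcal A,p,r)$ be an MDP as in the context. For every policy $\phi\in\Phi_{SD}$, $$\Delta(\phi)=\int_{\mathcal S}\mathrm{gap}(s,\phi(s))\,\mu^{(\infty)}_{\phi,p}(ds),$$ where $\Delta(\phi):=J^\star_{\mathcal M}-J_{\mathcal M}(\phi)$.
   Context: $\mathcal S=[0,1]^{d_{\mathcal S}}$ with Borel $\sigma$-algebra $\mathcal B_{\mathcal S}$, $\mathcal A=[0,1]^{d_{\mathcal A}}$; $\rho$ is the metric on $\mathcal S\times\mathcal A$. An MDP $\mathcal M=(\mathcal S,\mathcal A,p,r)$ has a transition kernel $p:\mathcal S\times\mathcal A\times\mathcal B_{\mathcal S}\to[0,1]$ and a measurable reward $r:\mathcal S\times\mathcal A\to[0,1]$. $\Phi_{SD}$ is the set of measurable maps $\phi:\mathcal S\to\mathcal A$ (policies playing $a_t=\phi(s_t)$). $J_{\mathcal M}(\phi)=\liminf_{T\to\infty}\frac1T\mathbb E_\phi[\sum_{t=0}^{T-1}r(s_t,a_t)]$ and $J^\star_{\mathcal M}=\sup_{\phi\in\Phi_{SD}}J_{\mathcal M}(\phi)$. For a difference $\nu$ of probability measures $\|\nu\|_{TV}=2\sup_B|\nu(B)|$. Standing assumptions. (Lipschitz) $|r(z)-r(z')|\le L_r\rho(z,z')$ and $\|p(z,\cdot)-p(z',\cdot)\|_{TV}\le L_p\rho(z,z')$ for all $z,z'\in\mathcal S\times\mathcal A$. (Uniform ergodicity) There are $C\in(0,\infty)$, $\alpha\in(0,1)$ such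 that for every $\phi\in\Phi_{SD}$ there is a unique distribution $\mu^{(\infty)}_{\phi,p}$ with $\|\mu^{(t)}_{\phi,p,s}-\mu^{(\infty)}_{\phi,p}\|_{TV}\le C\alpha^t$ for all $s\in\mathcal S$, $t\ge0$, where $\mu^{(t)}_{\phi,p,s}$ is the law of $s_t$ under $\phi$ started from $s_0=s$. Under these assumptions there is a bounded measurable $h_{\mathcal M}:\mathcal S\to\mathbb R$ (the relative value function) such that $J^\star_{\mathcal M}+h_{\mathcal M}(s)=\max_{a\in\mathcal A}\{r(s,a)+\int_{\mathcal S}h_{\mathcal M}(s')\,p(s,a,ds')\}$ for all $s$; it is made unique by $h_{\mathcal M}(s_\star)=0$ for a designated state $s_\star$. The suboptimality gap is $\mathrm{gap}(s,a)=J^\star_{\mathcal M}+h_{\mathcal M}(s)-r(s,a)-\int_{\mathcal S}h_{\mathcal M}(s')\,p(s,a,ds')$. *)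

(* Defs.v *)
From HB Require Import structures.
From mathcomp Require Import all_boot all_order all_algebra.
From mathcomp Require Import all_classical all_reals all_analysis.
From mathcomp Require Import measurable_realfun.

Set Implicit Arguments.
Unset Strict Implicit.
Unset Printing Implicit Defensive.
Import Order.TTheory GRing.Theory Num.Theory.
Import numFieldNormedType.Exports.
Local Open Scope classical_set_scope.
Local Open Scope ring_scope.

Definition unit_cube (R : realType) (d : nat) : set 'rV[R]_d :=
  [set x | forall i, 0 <= x ord0 i <= 1].
Arguments unit_cube : clear implicits.

(* [0,1]^d with the topology induced by R^d and its Borel sigma-algebra. *)
Definition cube (R : realType) (d : nat) : Type := set_type (unit_cube R d).

Section cube_instances.
Context (R : realType) (d : nat).

Lemma unit_cube0 : unit_cube R d 0.
Proof. by move=> i; rewrite mxE lexx ler01. Qed.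

HB.instance Definition _ := Topological.copy (cube R d) (set_type (unit_cube R d)).
HB.instance Definition _ := isPointed.Build (cube R d) (SigSub (mem_set unit_cube0)).
HB.instance Definition _ := @isMeasurable.Build
  (sigma_display (@open (cube R d))) (cube R d) <<s @open (cube R d) >>
  (@sigma_algebra0 _ setT _) (@sigma_algebraC (cube R d) _)
  (@sigma_algebra_bigcup _ setT _).

End cube_instances.

Section kernel_precomposition.
Context d1 d2 d3 (X : measurableType d1) (Y : measurableType d2)
  (Z : measurableType d3) (R : realType).
Variables (k : R.-pker Y ~> Z) (f : {mfun X >-> Y}).

Definition kprecomp (x : X) : {measure set Z -> \bar R} := k (f x).

Let measurable_kprecomp U : measurable U ->
  measurable_fun [set: X] (fun x => kprecomp x U).
Proof.
move=> mU; apply: (measurableT_comp (measurable_kernel k U mU)).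
exact: measurable_funPT.
Qed.

HB.instance Definition _ := isKernel.Build _ _ _ _ _ kprecomp measurable_kprecomp.

Let kprecomp_setT x : kprecomp x [set: Z] = 1%E.
Proof. exact: prob_kernel. Qed.

HB.instance Definition _ :=
  Kernel_isProbability.Build _ _ _ _ _ kprecomp kprecomp_setT.

End kernel_precomposition.

(* Law on X * Y of a pair (x, y) where x has law P and, given x, y has law k x. *)
Section semidirect_product.
Context d1 d2 (X : measurableType d1) (Y : measurableType d2) (R : realType).
Variables (P : probability X R) (k : R.-pker X ~> Y).
Local Open Scope ereal_scope.

Definition semidirect (U : set (X * Y)) : \bar R :=
  \int[P]_x k x (xsection U x).

Let semidirect0 : semidirect set0 = 0.
Proof.
by rewrite /semidirect integral0_eq// => x _; rewrite xsection0 measure0.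
Qed.

Let semidirect_ge0 U : 0 <= semidirect U.
Proof. exact: integral_ge0. Qed.

Let semidirect_sigma_additive : semi_sigma_additive semidirect.
Proof.
move=> F mF tF mUF; rewrite /semidirect.
rewrite [X in _ --> X](_ : _ =
    \sum_(n <oo) \int[P]_x k x (xsection (F n) x)); last first.
  rewrite -integral_nneseries//; last first.
    by move=> n; apply: measurable_fun_xsection_finite_kernel; rewrite inE.
  apply: eq_integral => x _; rewrite xsection_bigcup.
  apply/esym/cvg_lim => //.
  apply: (measure_sigma_additive _ (trivIset_xsection tF)) => n.
  exact: measurable_xsection.
by apply: is_cvg_ereal_nneg_natsum => n _; exact: integral_ge0.
Qed.

HB.instance Definition _ := isMeasure.Build _ _ _ semidirect
  semidirect0 semidirect_ge0 semidirect_sigma_additive.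

Let semidirect_setT : semidirect [set: X * Y] = 1.
Proof.
rewrite /semidirect (eq_integral (cst 1)); last first.
  move=> x _ /=; rewrite (_ : xsection _ _ = setT) ?prob_kernel//.
  by apply/seteqP; split => // y _; rewrite /xsection/= inE.
by rewrite integral_cst// mul1e; exact: probability_setT.
Qed.

HB.instance Definition _ :=
  Measure_isProbability.Build _ _ _ semidirect semidirect_setT.

End semidirect_product.

Section paths.
Context d (S : measurableType d).

Definition path1 (s : S) : 1.-tuple S := [tuple s].

Definition path_rcons n (ws : n.-tuple S * S) : n.+1.-tuple S :=
  [tuple (if unlift ord_max i is Some j then tnth ws.1 j else ws.2) | i < n.+1].

Let measurable_path1 : measurable_fun [set: S] path1.
Proof.
apply/measurable_fun_tnthP => i.
rewrite (_ : _ \o _ = id); first exact: measurable_id.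
by apply/funext => s /=; rewrite ord1.
Qed.

HB.instance Definition _ :=
  isMeasurableFun.Build _ _ _ _ path1 measurable_path1.

Let measurable_path_rcons n : measurable_fun [set: n.-tuple S * S] (@path_rcons n).
Proof.
apply/measurable_fun_tnthP => i.
case: (unliftP ord_max i) => [j ij|ij].
  rewrite (_ : _ \o _ = (@tnth n S ^~ j) \o fst).
    exact: (measurableT_comp (measurable_tnth j)).
  by apply/funext => ws /=; rewrite tnth_mktuple ij liftK.
rewrite (_ : _ \o _ = snd)//.
by apply/funext => ws /=; rewrite tnth_mktuple ij unlift_none.
Qed.

HB.instance Definition _ n :=
  isMeasurableFun.Build _ _ _ _ (@path_rcons n) (@measurable_path_rcons n).

Definition path_state n (i : 'I_n) (w : n.-tuple S) : S := tnth w i.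

HB.instance Definition _ n (i : 'I_n) :=
  isMeasurableFun.Build _ _ _ _ (path_state i) (measurable_tnth i).

End paths.

Record mdp d1 d2 (S : measurableType d1) (A : measurableType d2)
    (R : realType) := MDP {
  transition : R.-pker (S * A) ~> S ;
  reward : {mfun (S * A)%type >-> R} ;
  reward_bounds : forall z, 0 <= reward z <= 1 }.

Definition policy d1 d2 (S : measurableType d1) (A : measurableType d2) :=
  {mfun S >-> A}.

Section dynamics.
Context d1 d2 (S : measurableType d1) (A : measurableType d2) (R : realType).
Variables (M : mdp S A R) (phi : policy S A).

Definition last_state_action n (w : n.+1.-tuple S) : S * A :=
  (path_state ord_max w, phi (path_state ord_max w)).

Lemma measurable_last_state_action n :
  measurable_fun [set: n.+1.-tuple S] (@last_state_action n).
Proof.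
apply: measurable_fun_pair; first exact: measurable_funPT.
by apply: measurableT_comp; exact: measurable_funPT.
Qed.

HB.instance Definition _ n := isMeasurableFun.Build _ _ _ _
  (@last_state_action n) (@measurable_last_state_action n).

Definition next_state n : R.-pker n.+1.-tuple S ~> S :=
  kprecomp (transition M) (@last_state_action n).

(* Law of (s_0, ..., s_t) when s_0 has law nu and a_i = phi s_i. *)
Fixpoint path_law (nu : probability S R) (t : nat) :
    probability (t.+1.-tuple S) R :=
  match t with
  | 0 => distribution nu (@path1 _ S)
  | t'.+1 =>
      distribution (semidirect (path_law nu t') (next_state t'))
        (@path_rcons _ S t'.+1)
  end.

Definition state_law (s : S) (t : nat) : probability S R :=
  distribution (path_law (dirac s) t) (path_state ord_max).

(* sum_(t < T) r(s_t, a_t) along a path (s_0, ..., s_T). *)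
Definition cumulative_reward T (w : T.+1.-tuple S) : R :=
  \sum_(t < T) reward M (path_state (widen_ord (leqnSn T) t) w,
                         phi (path_state (widen_ord (leqnSn T) t) w)).

(* nu is the law of s_0; under uniform ergodicity the value does not depend on it. *)
Definition average_reward (nu : probability S R) : R :=
  limn_inf (fun T : nat =>
    T%:R^-1 * fine ('E_(path_law nu T)[@cumulative_reward T])%E).

End dynamics.

Definition optimal_average_reward d1 d2 (S : measurableType d1)
    (A : measurableType d2) (R : realType) (M : mdp S A R)
    (nu : probability S R) : R :=
  sup [set average_reward M phi nu | phi in [set: policy S A]].

Definition tv_norm d (T : measurableType d) (R : realType)
    (nu : set T -> \bar R) : \bar R :=
  (2%:E * ereal_sup [set `|nu B| | B in measurable])%E.

Definition is_metric (R : realType) (T : Type) (rho : T -> T -> R) : Prop :=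
  [/\ forall x y, 0 <= rho x y,
      forall x y, rho x y = 0 <-> x = y,
      forall x y, rho x y = rho y x &
      forall x y z, rho x z <= rho x y + rho y z].

Definition induces_topology (R : realType) (T : topologicalType)
    (rho : T -> T -> R) : Prop :=
  forall (x : T) (U : set T), nbhs x U <->
    exists2 e : R, 0 < e & [set y | rho x y < e] `<=` U.

Definition is_max (R : realType) (E : set R) (m : R) : Prop := E m /\ ubound E m.

Section assumptions.
Context d1 d2 (S : measurableType d1) (A : measurableType d2) (R : realType).
Variable M : mdp S A R.

Definition lipschitz_mdp (rho : S * A -> S * A -> R) (Lr Lp : R) : Prop :=
  (forall z z', `|reward M z - reward M z'| <= Lr * rho z z') /\
  (forall z z', (tv_norm (fun B => transition M z B - transition M z' B)
                 <= (Lp * rho z z')%:E)%E).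

Definition ergodic_limit (C alpha : R) (phi : policy S A)
    (mu : probability S R) : Prop :=
  forall (s : S) (t : nat),
    (tv_norm (fun B => state_law M phi s t B - mu B) <= (C * alpha ^+ t)%:E)%E.

(* Library measures are functions on all sets, constrained only on the
   measurable ones, so uniqueness is uniqueness on measurable sets. *)
Definition uniformly_ergodic (C alpha : R) : Prop :=
  [/\ 0 < C, 0 < alpha < 1 &
      forall phi : policy S A, exists2 mu : probability S R,
        ergodic_limit C alpha phi mu &
        forall mu' : probability S R, ergodic_limit C alpha phi mu' ->
          forall B, measurable B -> mu' B = mu B].

Definition relative_value (nu : probability S R) (sstar : S) (h : S -> R) :
    Prop :=
  [/\ measurable_fun [set: S] h, bounded_fun h, h sstar = 0 &
      forall s, is_max
        [set reward M (s, a) + \int[transition M (s, a)]_s' h s' | a in [set: A]]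
        (optimal_average_reward M nu + h s)].

Definition gap (nu : probability S R) (h : S -> R) (s : S) (a : A) : R :=
  optimal_average_reward M nu + h s - reward M (s, a)
  - \int[transition M (s, a)]_s' h s'.

Definition suboptimality (nu : probability S R) (phi : policy S A) : R :=
  optimal_average_reward M nu - average_reward M phi nu.

End assumptions.

(* Main.v *)
(* Let P be the transition operator of phi.  Uniform ergodicity bounds the total
   variation distance between P^t(s, -) and mu by C alpha^t uniformly in s, so
   the law of s_t converges to mu on bounded measurable functions whatever the
   law of s_0.  Hence J(phi) is the mu-mean of the reward, by Cesaro, and mu is
   P-invariant.  In the mu-mean of the gap the terms h and P h therefore cancel,
   which leaves J* - J(phi). *)
Require Import Defs.
From HB Require Import structures.
From mathcomp Require Import all_boot all_order all_algebra.
From mathcomp Require Import all_classical all_reals all_analysis.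
From mathcomp Require Import measurable_realfun.
From mathcomp Require Import lra.
Import Order.TTheory GRing.Theory Num.Theory.
Import numFieldNormedType.Exports.
Local Open Scope classical_set_scope.
Local Open Scope ring_scope.

Set Implicit Arguments.
Unset Strict Implicit.
Unset Printing Implicit Defensive.

(** * Integrals of bounded functions against probability measures *)

Section bounded_measurable.
Context d (T : measurableType d) (R : realType).
Variable mu : {measure set T -> \bar R}.
Hypothesis mu1 : mu [set: T] = 1%E.
Implicit Types f : T -> R.

Lemma integrable_bounded f (b : R) : measurable_fun [set: T] f ->
  (forall x, `|f x| <= b) -> mu.-integrable [set: T] (EFin \o f).
Proof.
move=> mf fb; apply: measurable_bounded_integrable => //; first by rewrite mu1 ltry.
by exists b; split; rewrite ?num_real // => M bM x _; exact: le_trans (fb x) (ltW bM).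
Qed.

Lemma integrable_cst_probability (r : R) : mu.-integrable [set: T] (EFin \o cst r).
Proof. exact: (@integrable_bounded _ `|r|). Qed.

Lemma Rintegral_probability_cst (r : R) : \int[mu]_x r = r.
Proof. by rewrite Rintegral_cst// mu1 mulr1. Qed.

Lemma Rintegral_bounded f (b : R) : measurable_fun [set: T] f ->
  (forall x, `|f x| <= b) -> `|\int[mu]_x f x| <= b.
Proof.
move=> mf fb; have fi := integrable_bounded mf fb.
rewrite (le_trans (le_normr_Rintegral _ fi))//.
rewrite -[leRHS](Rintegral_probability_cst _) le_Rintegral//.
- apply: (@integrable_bounded _ b); last by move=> x; rewrite normr_id.
  exact: measurableT_comp.
- exact: integrable_cst_probability.
Qed.

(** Total mass one makes integration commute with affine maps. This is used below to shift a bounded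
    function to a nonnegative one, to rescale it to [[0, 1]], and to move constants under the
    integral. *)
Lemma Rintegral_bounded_affine f (b a c : R) : measurable_fun [set: T] f ->
  (forall x, `|f x| <= b) ->
  \int[mu]_x (a * f x + c) = a * \int[mu]_x f x + c.
Proof.
move=> mf fb; have fi := integrable_bounded mf fb.
rewrite RintegralD//; last exact: integrable_cst_probability.
  by rewrite RintegralZl// Rintegral_probability_cst.
apply: (@integrable_bounded _ (`|a| * b)).
  exact: measurable_funM.
by move=> x; rewrite normrM ler_wpM2l.
Qed.

Lemma Rintegral_sum n (F : 'I_n -> T -> R) (b : R) :
  (forall i, measurable_fun [set: T] (F i)) -> (forall i x, `|F i x| <= b) ->
  \int[mu]_x (\sum_(i < n) F i x) = \sum_(i < n) \int[mu]_x F i x.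
Proof.
move=> mF Fb; elim: n F mF Fb => [|n IH] F mF Fb.
  rewrite big_ord0 -[RHS](Rintegral_probability_cst _).
  by apply: eq_Rintegral => x _; rewrite big_ord0.
under eq_Rintegral do rewrite big_ord_recr /=.
rewrite RintegralD// ?big_ord_recr/= ?IH//.
  apply: (@integrable_bounded _ (\sum_(i < n) b)).
    by apply: measurable_sum => i.
  move=> x; rewrite (le_trans (ler_norm_sum _ _ _))// ler_sum// => i _.
exact: integrable_bounded.
Qed.

End bounded_measurable.

Lemma Rintegral_pushforward d1 d2 (X : measurableType d1) (Y : measurableType d2)
    (R : realType) (P : probability X R) (g : {mfun X >-> Y}) (f : Y -> R) (b : R) :
  measurable_fun [set: Y] f -> (forall y, `|f y| <= b) ->
  \int[distribution P g]_y f y = \int[P]_x f (g x).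
Proof.
move=> mf fb; congr fine; rewrite /distribution /=.
rewrite integral_pushforward//; first exact/measurable_EFinP.
apply: (integrable_bounded (probability_setT P) (f := f \o g) (b := b)) => //.
  exact: measurableT_comp.
by move=> x /=.
Qed.

(** * Integration against the composition of a law with a kernel *)

Section kernel_composition.
Context d1 d2 (X : measurableType d1) (Y : measurableType d2) (R : realType).
Variables (P : probability X R) (k : R.-pker X ~> Y) (Q : probability Y R).
Hypothesis Qk : forall B, measurable B -> Q B = (\int[P]_x k x B)%E.

(** [kcomp] composes a kernel on [unit] with one on [unit * X]. So [P] is read as a constant kernel
    on [unit], and [k] is pulled back along [snd]. By [Qk] the result agrees with [Q] on measurable
    sets, hence gives the same integrals. *)
Lemma integral_kernel_composition (f : Y -> \bar R) :
  (forall y, 0 <= f y)%E -> measurable_fun [set: Y] f ->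
  (\int[Q]_y f y = \int[P]_x \int[k x]_y f y)%E.
Proof.
move=> f0 mf.
pose sndf : {mfun (unit * X)%type >-> X} := HB.pack snd
  (isMeasurableFun.Build _ _ _ _ (snd : unit * X -> X) measurable_snd).
pose l := kprobability (measurable_cst (P : pprobability X R) : measurable_fun [set: unit] _).
rewrite -[RHS](integral_kcomp l (kprecomp k sndf) tt f0 mf).
pose m2 : {measure set Y -> \bar R} := kcomp l (kprecomp k sndf) tt.
apply: (@eq_measure_integral _ _ _ setT m2 Q f) => B mB _.
exact: Qk.
Qed.

Lemma measurable_Rintegral_kernel (f : Y -> R) (b : R) :
  measurable_fun [set: Y] f -> (forall y, `|f y| <= b) ->
  measurable_fun [set: X] (fun x => \int[k x]_y f y).
Proof.
move=> mf fb.
(* Measurability of kernel integrals is applied to a nonnegative integrand, which adding the bound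
   [b] provides. The factor [1] matches the affine lemma. *)
have -> : (fun x => \int[k x]_y f y) = (fun x => \int[k x]_y (1 * f y + b) - b).
  by apply/funext => x; rewrite (Rintegral_bounded_affine (prob_kernel x) _ _ mf fb) mul1r addrK.
apply: measurable_funB => //.
apply: (measurableT_comp (fine_measurable (R := R) measurableT)) => //.
apply: measurable_fun_integral_kernel => //.
- by move=> U mU; exact: measurable_kernel.
- by move=> y; rewrite lee_fin mul1r -lerBlDr sub0r; have /ler_normlP[] := fb y; lra.
- by apply/measurable_EFinP; apply: measurable_funD => //; exact: measurable_funM.
Qed.

Lemma Rintegral_kernel_composition (f : Y -> R) (b : R) :
  measurable_fun [set: Y] f -> (forall y, `|f y| <= b) ->
  \int[Q]_y f y = \int[P]_x \int[k x]_y f y.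
Proof.
move=> mf fb; have mkf := measurable_Rintegral_kernel mf fb.
have kfb x : `|\int[k x]_y f y| <= b by exact: (Rintegral_bounded (prob_kernel x)).
(* Adding [b] to both sides replaces [f] by [1 * f + b], which is nonnegative, so the composition
   formula above applies. *)
apply: (addIr b); rewrite -[\int[Q]_y _]mul1r -[in RHS](mul1r (\int[P]_x _)).
rewrite -(Rintegral_bounded_affine (probability_setT _) _ _ mf fb).
rewrite -(Rintegral_bounded_affine (probability_setT _) _ _ mkf kfb).
rewrite [LHS]/Rintegral integral_kernel_composition.
- rewrite /Rintegral; congr fine; apply: eq_integral => x _.
  rewrite -(Rintegral_bounded_affine (prob_kernel x) _ _ mf fb) fineK//.
  apply: integrable_fin_num => //.
  apply: (integrable_bounded (prob_kernel x) (b := b + b)).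
    by apply: measurable_funD => //; exact: measurable_funM.
  move=> y; rewrite mul1r (le_trans (ler_normD _ _))// lerD//.
  by rewrite ger0_norm// (le_trans _ (fb y)).
- by move=> y; rewrite lee_fin mul1r -lerBlDr sub0r; have /ler_normlP[] := fb y; lra.
- by apply/measurable_EFinP; apply: measurable_funD => //; exact: measurable_funM.
Qed.

End kernel_composition.

(** The sum counts the naturals strictly below [y], so it is the ceiling of [y]. *)
Lemma count_lt_natr (R : realType) (y : R) (n : nat) : 0 <= y <= n%:R ->
  y <= \sum_(j < n) (j%:R < y)%R%:R <= y + 1.
Proof.
move=> /andP[y0 yn].
(* The hypothesis [y <= n%:R] does not pass from [n.+1] to [n]. Truncating both bounds at [n] gives
   a statement that holds without it and can be proved by induction. *)
suff [] : Num.min y n%:R <= \sum_(j < n) (j%:R < y)%R%:R /\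
    \sum_(j < n) (j%:R < y)%R%:R <= Num.min (y + 1) n%:R.
  by rewrite le_min min_l// => -> /andP[->].
elim: n {yn} => [|n [IHl IHu]]; first by rewrite big_ord0 ge_min lexx orbT le_min; split; lra.
rewrite big_ord_recr/=; move: IHl IHu; rewrite ge_min !le_min ge_min -natr1.
case: (ltrP n%:R y) => ny /= /orP IHl /andP[IHu1 IHu2]; split.
- by apply/orP; right; case: IHl; lra.
- by apply/andP; split; lra.
- by apply/orP; left; case: IHl; lra.
- by apply/andP; split; lra.
Qed.

(** * From bounds on sets to bounds on integrals *)

Section total_variation.
Context d (T : measurableType d) (R : realType).
Implicit Types (P Q : probability T R) (f : T -> R).

(* Approximating [f] within [n^-1] by the average of the indicators of the
   superlevel sets [f > j / n] turns the bound on sets into one on [f]. *)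
Lemma le_Rintegral_setwise P Q f (c : R) :
  measurable_fun [set: T] f -> (forall x, 0 <= f x <= 1) ->
  (forall B, measurable B -> fine (P B) <= fine (Q B) + c) ->
  \int[P]_x f x <= \int[Q]_x f x + c.
Proof.
move=> mf f01 PQ.
have fb x : `|f x| <= 1 by rewrite ger0_norm; case/andP: (f01 x).
apply/ler_addgt0Pr => e e0.
have [n ne] : exists n, n.+1%:R^-1 < e.
  by exists (Num.trunc e^-1); rewrite invf_plt ?posrE// truncnS_gt.
set N : R := n.+1%:R in ne; have N0 : 0 < N by rewrite ltr0n.
pose B (j : 'I_n.+1) := [set x | j%:R < N * f x].
have mB j : measurable (B j).
  have mNf : measurable_fun [set: T] (fun x => N * f x) by exact: measurable_funM.
  have := mNf measurableT _ (measurable_itv `]j%:R, +oo[); rewrite setTI.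
  congr measurable; apply/seteqP.
  by split => x /=; rewrite /B /= in_itv/= andbT.
(* The [+ 0] gives [F] the shape expected by [Rintegral_bounded_affine]. *)
pose F j x : R := N^-1 * \1_(B j) x + 0.
have m1 j : measurable_fun [set: T] (\1_(B j) : T -> R) by exact: measurable_indic.
have b1 j x : `|\1_(B j) x : R| <= 1 by rewrite indicE; case: (_ \in _); rewrite ?normr1// normr0.
have mF j : measurable_fun [set: T] (F j).
  by apply: measurable_funD => //; exact: measurable_funM.
have Fb j x : `|F j x| <= N^-1.
  by rewrite /F addr0 normrM gtr0_norm ?invr_gt0// ler_piMr// invr_ge0 ltW.
have IF (mu : probability T R) :
    \int[mu]_x (\sum_(j < n.+1) F j x) = \sum_(j < n.+1) (N^-1 * fine (mu (B j))).
  rewrite (Rintegral_sum (probability_setT mu) mF Fb); apply: eq_bigr => j _.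
  rewrite (Rintegral_bounded_affine (probability_setT mu) _ _ (m1 j) (b1 j)) addr0.
  by rewrite /Rintegral integral_indic// setIT.
(* The sum is the ceiling of [N * f x] divided by [N]. *)
have fF x : f x <= \sum_(j < n.+1) F j x <= f x + N^-1.
  have /andP[f0 f1] := f01 x.
  have : 0 <= N * f x <= n.+1%:R by rewrite (mulr_ge0 (ltW N0) f0) -/N ler_piMr// ltW.
  move=> /count_lt_natr.
  have -> : \sum_(j < n.+1) F j x = N^-1 * \sum_(j < n.+1) (j%:R < N * f x)%R%:R.
    rewrite mulr_sumr; apply: eq_bigr => j _; rewrite /F addr0 indicE.
    by rewrite /B /= mem_setE.
  by rewrite ler_pdivlMl// ler_pdivrMl// mulrDr divff ?gt_eqF.
have iS (mu : probability T R) :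
    mu.-integrable [set: T] (EFin \o fun x => \sum_(j < n.+1) F j x).
  apply: (integrable_bounded (probability_setT mu) (b := 1 + N^-1)).
    exact: measurable_sum.
  move=> x /=; have /andP[l1 l2] := fF x; have /andP[f0 f1] := f01 x.
  by rewrite ger0_norm ?(le_trans f0 l1)// (le_trans l2)// lerD2r.
have if_ (mu : probability T R) := integrable_bounded (probability_setT mu) mf fb.
have step1 : \int[P]_x f x <= \int[P]_x (\sum_(j < n.+1) F j x).
  by apply: (le_Rintegral _ (if_ P) (iS P)) => // x _; case/andP: (fF x).
have step2 : \int[Q]_x (\sum_(j < n.+1) F j x) <= \int[Q]_x f x + N^-1.
  rewrite -[\int[Q]_x f x]mul1r.
  rewrite -(Rintegral_bounded_affine (probability_setT Q) _ _ mf fb).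
  apply: (le_Rintegral _ (iS Q)) => //.
    apply: (integrable_bounded (probability_setT Q) (b := 1 + N^-1)).
      by apply: measurable_funD => //; exact: measurable_funM.
    move=> x /=; have /andP[l1 l2] := f01 x.
    by rewrite mul1r ger0_norm ?lerD2r// addr_ge0// invr_ge0 ltW.
  by move=> x _; rewrite mul1r; case/andP: (fF x).
(* Each of the [n.+1] superlevel sets contributes an error [N^-1 * c]. As [N] is [n.+1], the errors
   add up to [c]. *)
have step3 : \int[P]_x (\sum_(j < n.+1) F j x) <= \int[Q]_x (\sum_(j < n.+1) F j x) + c.
  rewrite !IF.
  apply: (@le_trans _ _ (\sum_(j < n.+1) (N^-1 * (fine (Q (B j)) + c)))).
    by apply: ler_sum => j _; rewrite ler_wpM2l ?invr_ge0 ?(ltW N0)//; exact: PQ.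
  under eq_bigr do rewrite mulrDr.
  by rewrite big_split/= sumr_const card_ord -mulr_natl mulrA divff ?gt_eqF// mul1r.
rewrite (le_trans step1)// (le_trans step3)// addrAC lerD2r (le_trans step2)//.
by rewrite lerD2l ltW.
Qed.

Lemma dist_Rintegral_setwise P Q f (b c : R) : 0 < b ->
  measurable_fun [set: T] f -> (forall x, `|f x| <= b) ->
  (forall B, measurable B -> `|fine (P B) - fine (Q B)| <= c) ->
  `|\int[P]_x f x - \int[Q]_x f x| <= 2 * b * c.
Proof.
move=> b0 mf fb PQ.
(* The affine map from [[-b, b]] onto [[0, 1]]; undoing it costs the factor [2 * b]. The one-sided
   bound is then used in both directions. *)
pose g x := (2 * b)^-1 * f x + 2^-1.
have b20 : 0 < 2 * b by lra.
have mg : measurable_fun [set: T] g.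
  by apply: measurable_funD => //; exact: measurable_funM.
have g01 x : 0 <= g x <= 1.
  have [l1 l2] := ler_normlP _ _ (fb x).
  have -> : g x = (2 * b)^-1 * (f x + b).
    by rewrite /g mulrDr; congr (_ + _); rewrite invfM -mulrA mulVf ?mulr1// gt_eqF.
  apply/andP; split; last by rewrite ler_pdivrMl//; lra.
  by apply: mulr_ge0; [rewrite invr_ge0 ltW|lra].
have Ig (mu : probability T R) : \int[mu]_x g x = (2 * b)^-1 * \int[mu]_x f x + 2^-1.
  exact: (Rintegral_bounded_affine (probability_setT mu) _ _ mf fb).
have H1 : \int[P]_x g x <= \int[Q]_x g x + c.
  by apply: le_Rintegral_setwise => // B mB; have /ler_normlP[] := PQ B mB; lra.
have H2 : \int[Q]_x g x <= \int[P]_x g x + c.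
  by apply: le_Rintegral_setwise => // B mB; have /ler_normlP[] := PQ B mB; lra.
have -> : \int[P]_x f x - \int[Q]_x f x = 2 * b * (\int[P]_x g x - \int[Q]_x g x).
  by rewrite !Ig opprD addrACA subrr addr0 -mulrBr mulVKf// gt_eqF.
rewrite normrM (gtr0_norm b20) ler_pM2l//.
by apply/ler_normlP; split; lra.
Qed.

(** The division by 2 undoes the factor 2 in [tv_norm]. Probabilities are finite, so [fine] loses
    nothing. *)
Lemma tv_norm_setwise P Q (c : R) :
  (tv_norm (fun B => P B - Q B) <= c%:E)%E ->
  forall B, measurable B -> `|fine (P B) - fine (Q B)| <= c / 2.
Proof.
move=> tv B mB.
rewrite ler_pdivlMr// mulrC -lee_fin; apply: le_trans tv; rewrite EFinM /tv_norm.
rewrite lee_pmul2l//; apply: ereal_sup_ubound; exists B => //.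
by rewrite -{1}(fineK (fin_num_measure P B mB)) -{1}(fineK (fin_num_measure Q B mB)).
Qed.

End total_variation.

Lemma bounded_fun_pos (T : Type) (R : realFieldType) (f : T -> R) :
  bounded_fun f -> exists2 b, 0 < b & forall s, `|f s| <= b.
Proof.
(* [bounded_fun] gives the bound only for numbers strictly above [N]; the [+ 1] ensures this and
   positivity. *)
move=> [N [_ fN]]; exists (`|N| + 1); first by rewrite ltr_wpDl.
by move=> s; apply: fN => //; rewrite ltr_pwDr// ler_norm.
Qed.

(** * The Markov chain induced by a policy *)

Section policy_chain.
Context d1 d2 (S : measurableType d1) (A : measurableType d2) (R : realType).
Variables (M : mdp S A R) (phi : policy S A).
Implicit Types (nu : probability S R) (f : S -> R) (b : R).

Definition policy_graph (s : S) : S * A := (s, phi s).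

Lemma measurable_policy_graph : measurable_fun [set: S] policy_graph.
Proof. by apply: measurable_fun_pair => //; exact: measurable_funPT. Qed.

HB.instance Definition _ :=
  isMeasurableFun.Build _ _ _ _ policy_graph measurable_policy_graph.

Definition policy_kernel : R.-pker S ~> S := kprecomp (transition M) policy_graph.

(** Extends [state_law] to an arbitrary initial law; the Dirac mass at [s] gives back
    [state_law M phi s]. *)
Definition marginal (nu : probability S R) (t : nat) : probability S R :=
  distribution (path_law M phi nu t) (path_state ord_max).

Definition transition_operator (f : S -> R) (s : S) : R :=
  \int[policy_kernel s]_s' f s'.

(** The coordinate [i] is arbitrary so that both the appended state ([i = ord_max]) and the earlier
    states are covered. *)
Lemma path_lawS (nu : probability S R) t (i : 'I_t.+2) B : measurable B ->
  path_law M phi nu t.+1 (path_state i @^-1` B) =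
  (\int[path_law M phi nu t]_w policy_kernel (path_state ord_max w)
     [set s | B (path_state i (path_rcons (w, s)))])%E.
Proof.
move=> mB; rewrite /= /distribution /pushforward /= /semidirect.
apply: eq_integral => w _; congr (policy_kernel _ _).
by rewrite xsectionE.
Qed.

Lemma marginal0 (nu : probability S R) B : marginal nu 0 B = nu B.
Proof. by rewrite /marginal /= /distribution /pushforward /=; congr (nu _). Qed.

Lemma marginalS (nu : probability S R) t B : measurable B ->
  marginal nu t.+1 B = (\int[marginal nu t]_s policy_kernel s B)%E.
Proof.
move=> mB; rewrite /marginal /distribution /=.
rewrite [LHS](path_lawS nu _ mB) ge0_integral_pushforward//=.
  apply: eq_integral => w _ /=; congr (policy_kernel _ _).
  by apply/seteqP; split => s; rewrite /path_state /path_rcons /= tnth_mktuple unlift_none.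
exact: measurable_kernel.
Qed.

(** Extending a path leaves the law of its earlier states unchanged, because the kernel has total
    mass one. *)
Lemma path_law_marginal (nu : probability S R) t (i : 'I_t.+1) B : measurable B ->
  path_law M phi nu t (path_state i @^-1` B) = marginal nu i B.
Proof.
move=> mB; elim: t i => [|t IH] i.
  by rewrite (ord1 i) /marginal /distribution /pushforward (_ : ord_max = ord0)//; apply/val_inj.
case: (unliftP ord_max i) => [j ij|->//].
have ij' : i = j :> nat by rewrite ij lift_max.
rewrite ij' -IH (path_lawS nu _ mB).
rewrite (eq_integral (fun w => (\1_(path_state j @^-1` B) w)%:E)) => [|w _].
  by rewrite integral_indic ?setIT// -[X in measurable X]setTI; exact: measurable_funPT.
(* The event concerns an old coordinate, so it does not depend on the new state: its conditional
   probability is 1 or 0. *)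
rewrite indicE (_ : [set s | _] = if w \in path_state j @^-1` B then setT else set0).
  by case: ifPn => _; rewrite ?measure0// prob_kernel.
apply/seteqP; split => s /=; rewrite /path_state /path_rcons /= tnth_mktuple ij liftK.
  by move=> Bw; rewrite mem_set.
by case: ifPn => //; rewrite inE.
Qed.

Lemma measurable_transition_operator f b : measurable_fun [set: S] f ->
  (forall s, `|f s| <= b) -> measurable_fun [set: S] (transition_operator f).
Proof. exact: measurable_Rintegral_kernel. Qed.

Lemma transition_operator_bounded f b : measurable_fun [set: S] f ->
  (forall s, `|f s| <= b) -> forall s, `|transition_operator f s| <= b.
Proof. by move=> mf fb s; exact: (Rintegral_bounded (prob_kernel s)). Qed.

Lemma measurable_iter_transition f b t : measurable_fun [set: S] f ->
  (forall s, `|f s| <= b) ->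
  measurable_fun [set: S] (iter t transition_operator f) /\
  (forall s, `|iter t transition_operator f s| <= b).
Proof.
move=> mf fb; elim: t => //= t [mt tb]; split.
  exact: measurable_transition_operator tb.
exact: transition_operator_bounded.
Qed.

Lemma Rintegral_marginalS nu t f b : measurable_fun [set: S] f ->
  (forall s, `|f s| <= b) ->
  \int[marginal nu t.+1]_s f s = \int[marginal nu t]_s transition_operator f s.
Proof. exact: (Rintegral_kernel_composition (@marginalS nu t)). Qed.

Lemma Rintegral_marginal nu t f b : measurable_fun [set: S] f ->
  (forall s, `|f s| <= b) ->
  \int[marginal nu t]_s f s = \int[nu]_s iter t transition_operator f s.
Proof.
(* [f] stays general: peeling off the last step replaces it by [transition_operator f]. *)
elim: t f => [|t IH] f mf fb.
  by congr fine; apply: eq_measure_integral => B mB _; exact: marginal0.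
rewrite (Rintegral_marginalS _ _ mf fb) IH.
- by apply: eq_Rintegral => s _; rewrite iterSr.
- exact: measurable_transition_operator fb.
- exact: transition_operator_bounded.
Qed.

Lemma Rintegral_state_law s t f b : measurable_fun [set: S] f ->
  (forall s, `|f s| <= b) ->
  \int[state_law M phi s t]_s' f s' = iter t transition_operator f s.
Proof.
move=> mf fb; rewrite [LHS](Rintegral_marginal (dirac s) t mf fb).
have [mt _] := measurable_iter_transition t mf fb.
rewrite /Rintegral (integral_dirac s measurableT); last exact/measurable_EFinP.
by rewrite diracT mul1e.
Qed.

(** * Ergodic limits, the average reward and the gap identity *)

Section ergodic.
Variables (C alpha : R) (mu : probability S R).
Hypothesis ergodic_mu : ergodic_limit M C alpha phi mu.

(** The ergodicity bound is uniform in the starting state, so it survives averaging over [nu]. *)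
Lemma dist_marginal_ergodic nu t f b : 0 < b -> measurable_fun [set: S] f ->
  (forall s, `|f s| <= b) ->
  `|\int[marginal nu t]_s f s - \int[mu]_s f s| <= b * C * alpha ^+ t.
Proof.
move=> b0 mf fb; have [mt tb] := measurable_iter_transition t mf fb.
rewrite (Rintegral_marginal _ _ mf fb).
have -> : \int[nu]_s iter t transition_operator f s - \int[mu]_s f s =
    \int[nu]_s (1 * iter t transition_operator f s + - \int[mu]_s f s).
  by rewrite (Rintegral_bounded_affine (probability_setT nu) _ _ mt tb) mul1r.
apply: (Rintegral_bounded (probability_setT nu)).
  by apply: measurable_funD => //; exact: measurable_funM.
move=> s; rewrite mul1r -(Rintegral_state_law s t mf fb).
(* The factor [2 * b] comes from the range of [f], the half from [tv_norm]. *)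
have -> : b * C * alpha ^+ t = 2 * b * (C * alpha ^+ t / 2) by lra.
apply: dist_Rintegral_setwise => //.
exact: tv_norm_setwise (ergodic_mu s t).
Qed.

Hypothesis alpha01 : 0 < alpha < 1.

Lemma cvg_marginal_ergodic nu f b : 0 < b -> measurable_fun [set: S] f ->
  (forall s, `|f s| <= b) ->
  (fun t => \int[marginal nu t]_s f s) @ \oo --> \int[mu]_s f s.
Proof.
move=> b0 mf fb; apply/cvgrPdistC_le.
have C0 : geometric (b * C) alpha @ \oo --> 0.
  by case/andP: alpha01 => a0 a1; apply: cvg_geometric; rewrite gtr0_norm.
move=> e e0; near=> t.
rewrite (le_trans (dist_marginal_ergodic nu t b0 mf fb))// (le_trans (ler_norm _))//.
near: t; exact: (cvgr0_norm_le _ C0).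
Unshelve. all: by end_near. Qed.

(** Start the chain from [mu]. The mean of [f] at time [t.+1] is the mean of [transition_operator f]
    at time [t], so the limits of the two sequences coincide. *)
Lemma Rintegral_ergodic_invariant f b : 0 < b -> measurable_fun [set: S] f ->
  (forall s, `|f s| <= b) ->
  \int[mu]_s transition_operator f s = \int[mu]_s f s.
Proof.
move=> b0 mf fb.
have mP := measurable_transition_operator mf fb.
have Pb := transition_operator_bounded mf fb.
have H1 := cvg_marginal_ergodic mu b0 mP Pb.
have H2 := cvg_marginal_ergodic mu b0 mf fb.
apply: (cvg_unique _ H1) => //.
rewrite -(cvg_shiftS (fun t => \int[marginal mu t]_s f s)) in H2.
apply: cvg_trans H2; apply: near_eq_cvg; near=> t.
by rewrite /= (Rintegral_marginalS _ _ mf fb).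
Unshelve. all: by end_near. Qed.

Let reward_phi s := reward M (s, phi s).

Lemma measurable_reward_phi : measurable_fun [set: S] reward_phi.
Proof.
apply: (measurableT_comp (f := reward M)); first exact: measurable_funPT.
exact: measurable_policy_graph.
Qed.

Lemma reward_phi_bounded s : `|reward_phi s| <= 1.
Proof. by have /andP[r0 r1] := reward_bounds M (s, phi s); rewrite ger0_norm. Qed.

(** Linearity reduces the expectation to single coordinates of the path, whose laws are the
    marginals. The path has [T.+1] states, and the last earns no reward. *)
Lemma expectation_cumulative_reward nu T :
  fine ('E_(path_law M phi nu T)[@cumulative_reward _ _ _ _ _ M phi T])%E =
  \sum_(t < T) \int[marginal nu t]_s reward_phi s.
Proof.
rewrite unlock.
transitivity (\int[path_law M phi nu T]_w \sum_(t < T)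
    reward_phi (path_state (widen_ord (leqnSn T) t) w)) => //.
rewrite (Rintegral_sum (probability_setT _) (b := 1)).
- apply: eq_bigr => t _.
  rewrite -(Rintegral_pushforward _ _ measurable_reward_phi reward_phi_bounded).
  congr fine; apply: eq_measure_integral => B mB _.
  exact: (path_law_marginal nu (widen_ord (leqnSn T) t) mB).
- by move=> t; apply: (measurableT_comp measurable_reward_phi); exact: measurable_funPT.
- by move=> t w; exact: reward_phi_bounded.
Qed.

Lemma average_reward_ergodic nu :
  average_reward M phi nu = \int[mu]_s reward M (s, phi s).
Proof.
have := cvg_marginal_ergodic nu ltr01 measurable_reward_phi reward_phi_bounded.
move=> /cesaro; rewrite /arithmetic_mean => c.
rewrite /average_reward.
apply: (cvg_limn_inf_sup _).1.
(* The arithmetic mean at index [n] has [n.+1] terms, so it matches the horizon [T = n.+1]. The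
   shift drops [T = 0], where the inverse takes its default value 0. *)
rewrite -cvg_shiftS; apply: cvg_trans c; apply: near_eq_cvg.
near=> n.
by rewrite /= expectation_cumulative_reward /series /= big_mkord.
Unshelve. all: by end_near. Qed.

Lemma suboptimality_Rintegral_gap nu f b : 0 < b -> measurable_fun [set: S] f ->
  (forall s, `|f s| <= b) ->
  suboptimality M nu phi = \int[mu]_s gap M nu f s (phi s).
Proof.
move=> b0 mf fb; set J := optimal_average_reward M nu.
have mu1 := probability_setT mu.
have ir := integrable_bounded mu1 measurable_reward_phi reward_phi_bounded.
have iF := integrable_bounded mu1 mf fb.
have iP := integrable_bounded mu1 (measurable_transition_operator mf fb)
  (transition_operator_bounded mf fb).
have iJ := integrable_cst_probability mu1 J.
have iJf : mu.-integrable setT (EFin \o (fun s => J + f s)).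
  exact: (integrableD measurableT iJ iF).
have iJfr : mu.-integrable setT (EFin \o (fun s => J + f s - reward_phi s)).
  exact: (integrableB measurableT iJf ir).
rewrite /suboptimality average_reward_ergodic.
(* The integral inside [gap] at [phi s] is [transition_operator f s] by conversion, which lets [iP]
   apply. *)
rewrite [RHS](RintegralB _ iJfr iP)// RintegralB// RintegralD//.
rewrite (Rintegral_ergodic_invariant b0 mf fb).
by rewrite (Rintegral_probability_cst mu1) [RHS]addrAC addrK.
Qed.

End ergodic.

End policy_chain.

Theorem lemma4p1 (R : realType) (dS dA : nat)
    (M : mdp (cube R dS) (cube R dA) R)
    (rho : cube R dS * cube R dA -> cube R dS * cube R dA -> R)
    (Lr Lp C alpha : R)
    (nu : probability (cube R dS) R)
    (sstar : cube R dS) (h : cube R dS -> R) :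
  is_metric rho -> induces_topology rho ->
  lipschitz_mdp M rho Lr Lp ->
  uniformly_ergodic M C alpha ->
  relative_value M nu sstar h ->
  forall (phi : policy (cube R dS) (cube R dA)) (mu : probability (cube R dS) R),
    ergodic_limit M C alpha phi mu ->
    suboptimality M nu phi = \int[mu]_s gap M nu h s (phi s).
Proof.
move=> _ _ _ [_ alpha01 _] [mh /bounded_fun_pos[b b0 hb] _ _] phi mu erg.
exact: suboptimality_Rintegral_gap erg alpha01 nu _ _ b0 mh hb.
Qed.
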